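(* For every constant $c$ there exist $n$ and a node $\Gamma_n$ of covtree with $k=|\Gamma_n|$ such that $\Gamma_n$ has no witness of size at most $n+k+c$.
   Context: Posets are finite; an unlabelled poset is an isomorphism class. A downset of $Q$ is a subset closed downward. $D_n(Q)$ denotes the set of downsets of $Q$ of size $n$ up to isomorphism. For a set $\Gamma_n$ of distinct unlabelled posets each of size $n$, a poset $Q$ is a witness of $\Gamma_n$ if $D_n(Q)=\Gamma_n$. A node of covtree (at level $n$) is a set $\Gamma_n$ of unlabelled posets of size $n$ that has at least one witness. *)

(* Defs.v *)
From mathcomp Require Import all_boot.
Set Implicit Arguments. Unset Strict Implicit. Unset Printing Implicit Defensive.

Record fposet := FPoset {
  pcard : nat;
  ple : rel 'I_pcard;
  ple_refl : reflexive ple;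
  ple_anti : antisymmetric ple;
  ple_trans : transitive ple }.

(* Order isomorphism: two labelled posets represent the same unlabelled poset. *)
Definition poset_iso (P Q : fposet) : Prop :=
  exists f : 'I_(pcard P) -> 'I_(pcard Q),
    bijective f /\ forall x y, @ple P x y = @ple Q (f x) (f y).

Definition is_downset (Q : fposet) (D : {set 'I_(pcard Q)}) : Prop :=
  forall x y, @ple Q y x -> x \in D -> y \in D.

Definition iso_to_sub (P Q : fposet) (D : {set 'I_(pcard Q)}) : Prop :=
  exists f : 'I_(pcard P) -> 'I_(pcard Q),
    [/\ injective f,
        (forall y, y \in D <-> exists x, f x = y) &
        forall x y, @ple P x y = @ple Q (f x) (f y)].

(* Gamma : 'I_k -> fposet lists representatives of k distinct unlabelled
   posets.  Q is a witness of Gamma at level n: D_n(Q) = Gamma, i.e. every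
   downset of Q of size n is isomorphic to some Gamma i, and every Gamma i is
   isomorphic to some downset of Q. *)
Definition witness (n k : nat) (Gamma : 'I_k -> fposet) (Q : fposet) : Prop :=
  (forall D : {set 'I_(pcard Q)}, is_downset D -> #|D| = n ->
      exists i, iso_to_sub (Gamma i) D) /\
  (forall i, exists D : {set 'I_(pcard Q)}, is_downset D /\ iso_to_sub (Gamma i) D).

Definition covtree_node (n k : nat) (Gamma : 'I_k -> fposet) : Prop :=
  [/\ (forall i, pcard (Gamma i) = n),
      (forall i j, poset_iso (Gamma i) (Gamma j) -> i = j) &
      exists Q, witness n Gamma Q].

(* Main.v *)
Require Import Defs.
From mathcomp Require Import all_boot zify.
Set Implicit Arguments. Unset Strict Implicit. Unset Printing Implicit Defensive.

(* Take n = 2p+2 and the node of the p+2 posets C_(n-s) + C_s (1 <= s <= p+1) and C_1 + Y,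
   where C_s is a chain and Y is a chain of 2p-1 points capped by two incomparable maximal
   points; C_(2p+1) + Y is a witness.  In any witness Q, take downsets copying C_(2p+1) + C_1
   and C_1 + Y, and let K and F be the copies of C_(2p+1) and of Y.  If K and F met, they
   would share their least element r; adding to K a minimal point of F outside K (there is
   one, since F is not a chain) would give a downset of size n with least element r, but no
   poset of the node has a least element.  So K and F are disjoint and |Q| >= 4p+2, which
   exceeds n + k + c = 3p + 4 + c for p = c + 3. *)

Lemma card_ord_range N l h : h <= N -> #|[set y : 'I_N | l <= y < h]| = h - l.
Proof.
elim: h => [|h IH] hN.
  by apply/eqP; rewrite cards_eq0; apply/eqP/setP => y; rewrite !inE; lia.
have hN' : h < N by lia.
case: (leqP l h) => lh.
  have -> : [set y : 'I_N | l <= y < h.+1] = Ordinal hN' |: [set y : 'I_N | l <= y < h].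
    by apply/setP => y; rewrite !inE -val_eqE /=; lia.
  rewrite cardsU1 inE /= IH; lia.
have -> : [set y : 'I_N | l <= y < h.+1] = [set y : 'I_N | l <= y < h].
  by apply/setP => y; rewrite !inE; lia.
rewrite IH; lia.
Qed.

Lemma card_ord_lt N h : h <= N -> #|[set y : 'I_N | y < h]| = h.
Proof.
move=> hN; rewrite -[h in RHS]subn0 -(card_ord_range 0 hN).
by apply: eq_card => y; rewrite !inE.
Qed.

Lemma ord_set_interval N l (S : {set 'I_N}) :
  (forall x : 'I_N, x \in S -> l <= x) ->
  (forall x y : 'I_N, l <= y -> y <= x -> x \in S -> y \in S) ->
  forall x : 'I_N, (x \in S) = (l <= x < l + #|S|).
Proof.
move=> Sl Sdown x; apply/idP/idP => [xS|/andP[lx]].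
  have sub : [set y : 'I_N | l <= y < x.+1] \subset S.
    by apply/subsetP => y; rewrite inE => /andP[ly yx]; apply: (Sdown x) => //; lia.
  have := subset_leq_card sub; rewrite card_ord_range //.
  by have := Sl x xS; set s := #|S|; lia.
apply: contraLR => xS.
have sub : S \subset [set y : 'I_N | l <= y < x].
  apply/subsetP => y yS; rewrite inE Sl //= ltnNge; apply/negP => xy.
  by move/negP: xS; apply; apply: (Sdown y).
have := subset_leq_card sub; rewrite card_ord_range; last by have := ltn_ord x; lia.
lia.
Qed.

(* The chain [0, a) beside the chain [a, N); if [forked], the top two points N-2 and N-1 are
   made incomparable, turning the second chain into a copy of Y. *)
Definition two_chains_le N a (forked : bool) (i j : nat) : bool :=
  (i == j) ||
  ((i < j) && ((j < a) || ((a <= i) && ~~ [&& forked, j == N.-1 & i == N.-2]))).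

Lemma two_chains_le_refl N a forked :
  reflexive (fun i j : 'I_N => two_chains_le N a forked i j).
Proof. by move=> i; rewrite /two_chains_le eqxx. Qed.

Lemma two_chains_le_anti N a forked :
  antisymmetric (fun i j : 'I_N => two_chains_le N a forked i j).
Proof. move=> i j /=; rewrite /two_chains_le => le_ij; apply/val_inj => /=; lia. Qed.

Lemma two_chains_le_trans N a forked :
  transitive (fun i j : 'I_N => two_chains_le N a forked i j).
Proof. move=> j i k /=; rewrite /two_chains_le => le_ij le_jk; have := ltn_ord k; lia. Qed.

Definition two_chains N a forked : fposet :=
  FPoset (@two_chains_le_refl N a forked) (@two_chains_le_anti N a forked)
         (@two_chains_le_trans N a forked).

Lemma two_chains_le_leq N a forked i j : two_chains_le N a forked i j -> i <= j.
Proof. rewrite /two_chains_le; lia. Qed.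

Lemma two_chains_no_least N a forked (x : 'I_N) :
  0 < a < N -> ~ (forall y : 'I_N, two_chains_le N a forked x y).
Proof.
move=> aN x_least; have N0 : 0 < N by lia.
have N1 : N.-1 < N by lia.
by have := x_least (Ordinal N0); have := x_least (Ordinal N1); rewrite /two_chains_le /=; lia.
Qed.

Lemma two_chains_downset N a forked (inD : pred nat) :
  (forall x y, x < N -> two_chains_le N a forked y x -> inD x -> inD y) ->
  @is_downset (two_chains N a forked) [set y : 'I_N | inD y].
Proof. by move=> inD_down x y /= yx; rewrite !inE; apply: inD_down. Qed.

Lemma iso_to_sub_two_chains N a forked M b forked' (inD : pred nat) (D : {set 'I_M})
    (g h : nat -> nat) :
  (forall y : 'I_M, (y \in D) = inD y) ->
  (forall x, x < N -> [/\ g x < M, inD (g x) & h (g x) = x]) ->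
  (forall y, y < M -> inD y -> h y < N /\ g (h y) = y) ->
  (forall x x', x < N -> x' < N ->
     two_chains_le N a forked x x' = two_chains_le M b forked' (g x) (g x')) ->
  @iso_to_sub (two_chains N a forked) (two_chains M b forked') D.
Proof.
move=> Dchar gP hP g_le.
have gM (x : 'I_N) : g x < M by case: (gP x (ltn_ord x)).
exists (fun x : 'I_N => Ordinal (gM x)); split.
- move=> x x' /(congr1 val) /= gxx'; apply: val_inj.
  case: (gP x (ltn_ord x)) (gP x' (ltn_ord x')) => _ _ hgx [_ _ hgx'].
  by rewrite /= -hgx -hgx' gxx'.
- move=> y; rewrite Dchar; split => [Dy | [x <-] /=]; last by case: (gP x (ltn_ord x)).
  by case: (hP y (ltn_ord y) Dy) => hN ghy; exists (Ordinal hN); apply/val_inj.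
- by move=> x x' /=; apply: g_le.
Qed.

Definition cmp_count (P : fposet) (x : 'I_(pcard P)) :=
  #|[set y | @ple P x y || @ple P y x]|.

Lemma cmp_count_iso (P Q : fposet) (f : 'I_(pcard P) -> 'I_(pcard Q)) :
  bijective f -> (forall x y, @ple P x y = @ple Q (f x) (f y)) ->
  forall x, cmp_count x = cmp_count (f x).
Proof.
move=> bij_f f_le x; rewrite /cmp_count -(card_imset _ (bij_inj bij_f)).
apply: eq_card => z; case: bij_f => g fK gK.
apply/imsetP/idP => [[y]|]; rewrite !inE; first by move=> xy ->; rewrite -!f_le.
by move=> xz; exists (g z); rewrite ?inE ?f_le gK.
Qed.

Lemma cmp_count_two_chains N a (x : 'I_N) : a <= N ->
  @cmp_count (two_chains N a false) x = if x < a then a else N - a.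
Proof.
move=> aN; rewrite /cmp_count /=; case: ifP => xa.
  apply: etrans (card_ord_lt aN); apply: eq_card => z; rewrite !inE /two_chains_le.
  have := ltn_ord z; lia.
apply: etrans (card_ord_range a (leqnn N)); apply: eq_card => z; rewrite !inE /two_chains_le.
have := ltn_ord z; lia.
Qed.

Lemma cmp_count_fork_bottom N (x : 'I_N) : x = 0 :> nat ->
  @cmp_count (two_chains N 1 true) x = 1.
Proof.
move=> x0; rewrite /cmp_count /=.
apply: etrans (@card_ord_lt N 1 _); last by have := ltn_ord x; lia.
by apply: eq_card => z; rewrite !inE /two_chains_le; have := ltn_ord z; lia.
Qed.

Lemma cmp_count_fork_top N (x : 'I_N) : 2 < N -> x = N.-1 :> nat ->
  @cmp_count (two_chains N 1 true) x = N - 2.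
Proof.
move=> N2 xtop; rewrite /cmp_count /=.
have -> : [set y : 'I_N | two_chains_le N 1 true x y || two_chains_le N 1 true y x] =
          [set y : 'I_N | 1 <= y < N - 2] :|: [set y : 'I_N | N.-1 <= y < N].
  by apply/setP => z; rewrite !inE /two_chains_le; have := ltn_ord z; lia.
rewrite cardsU !card_ord_range //; try lia.
have -> : [set y : 'I_N | 1 <= y < N - 2] :&: [set y : 'I_N | N.-1 <= y < N] = set0.
  by apply/setP => z; rewrite !inE; lia.
rewrite cards0; lia.
Qed.

Lemma forked_downset_shape N m (D : {set 'I_N}) :
  m.+2 <= N -> @is_downset (two_chains N m true) D ->
  exists a b (top : bool),
    [/\ a <= m, b <= N.-1 - m, top -> N.-2 - m <= b, #|D| = a + b + top
      & forall y : 'I_N, (y \in D) = [|| y < a, m <= y < m + b | top && (y == N.-1 :> nat)]].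
Proof.
move=> mN Ddown.
pose A := D :&: [set y : 'I_N | y < m]; pose a := #|A|.
pose B := D :&: [set y : 'I_N | m <= y < N.-1]; pose b := #|B|.
have Ntop : N.-1 < N by lia.
pose top := Ordinal Ntop \in D.
have Achar (y : 'I_N) : (y \in A) = (0 <= y < 0 + a).
  apply: ord_set_interval => // x {}y _ yx; rewrite !inE => /andP[Dx xm].
  apply/andP; split; last by lia.
  by apply: (Ddown x) Dx; rewrite /= /two_chains_le; lia.
have Bchar (y : 'I_N) : (y \in B) = (m <= y < m + b).
  apply: ord_set_interval => [x|x {}y my yx]; rewrite !inE; first by case/andP => _ /andP[].
  case/andP=> Dx /andP[mx xN]; apply/andP; split; last by lia.
  by apply: (Ddown x) Dx; rewrite /= /two_chains_le; lia.
have am : a <= m.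
  by have := subset_leq_card (subsetIr D [set y : 'I_N | y < m]); rewrite -/A -/a card_ord_lt; lia.
have bm : b <= N.-1 - m.
  have := subset_leq_card (subsetIr D [set y : 'I_N | m <= y < N.-1]).
  by rewrite -/B -/b card_ord_range; lia.
have Dchar (y : 'I_N) : (y \in D) = [|| y < a, m <= y < m + b | top && (y == N.-1 :> nat)].
  have := Achar y; have := Bchar y; rewrite !inE; have := ltn_ord y.
  case: (boolP (y == N.-1 :> nat)) => ytop.
    have -> : y = Ordinal Ntop by apply/val_inj/eqP.
    by rewrite /top; case: (_ \in D) => /=; lia.
  case: (y \in D) => /=; lia.
exists a, b, top; split => //.
- move=> topD.
  have sub : [set y : 'I_N | m <= y < N.-2] \subset B.
    apply/subsetP => y; rewrite !inE => /andP[my yN]; rewrite my /=.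
    by apply/andP; split; [apply: (Ddown (Ordinal Ntop)) topD; rewrite /= /two_chains_le|]; lia.
  by have := subset_leq_card sub; rewrite -/b card_ord_range; lia.
- rewrite -(cardsID [set y : 'I_N | y < m] D) -/A -/a -addnA; congr (_ + _).
  rewrite -(cardsID [set y : 'I_N | y < N.-1] (D :\: _)).
  have -> : (D :\: [set y : 'I_N | y < m]) :&: [set y : 'I_N | y < N.-1] = B.
    by apply/setP => y; rewrite !inE; case: (y \in D) => /=; lia.
  have -> : (D :\: [set y : 'I_N | y < m]) :\: [set y : 'I_N | y < N.-1] =
            if top then [set Ordinal Ntop] else set0.
    apply/setP => y; rewrite !inE Dchar; have := ltn_ord y.
    by case: top Dchar => _ /=; rewrite ?inE -?val_eqE /=; lia.
  by case: top Dchar => _; rewrite ?cards1 ?cards0.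
Qed.

Section Construction.
Variable p : nat.

Definition node_size := (2 * p).+2.

Definition node_split (i : nat) := if i < p.+1 then node_size - i.+1 else 1.

(* [node i] is C_(n-i-1) + C_(i+1) for i <= p, and C_1 + Y for i = p+1. *)
Definition node (i : 'I_p.+2) : fposet := two_chains node_size (node_split i) (p.+1 <= i).

Definition witness_poset : fposet := two_chains (4 * p).+2 (2 * p).+1 true.

Ltac case_ifs := repeat match goal with
  |- context[if ?b then _ else _] =>
     lazymatch b with context[if _ then _ else _] => fail | _ =>
     let E := fresh "E" in destruct b eqn:E end end.
Ltac node_arith := unfold two_chains_le, node_split, node_size in *; simpl in *; case_ifs; lia.

Lemma node_in_witness_poset (i : 'I_p.+2) :
  exists D : {set 'I_(pcard witness_poset)}, is_downset D /\ iso_to_sub (node i) D.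
Proof.
have ip := ltn_ord i; rewrite /node /node_split; case: ifP => ilt.
  pose inD y := (y < node_size - i.+1) || ((2 * p).+1 <= y < (2 * p).+1 + i.+1).
  exists [set y : 'I_(4 * p).+2 | inD y]; split.
    by apply: two_chains_downset => x y xN yx; rewrite /inD; node_arith.
  apply: (@iso_to_sub_two_chains _ _ _ _ _ _ inD _
            (fun x => if x < node_size - i.+1 then x else x + i)
            (fun y => if y < (2 * p).+1 then y else y - i)).
  - by move=> y; rewrite inE.
  - by move=> x xN; rewrite /inD; split; node_arith.
  - by move=> y yN; rewrite /inD; node_arith.
  - by move=> x x' xN xN'; node_arith.
rewrite (_ : p.+1 <= i = true); last by lia.
pose inD y := (y == 0) || ((2 * p).+1 <= y).
exists [set y : 'I_(4 * p).+2 | inD y]; split.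
  by apply: two_chains_downset => x y xN yx; rewrite /inD; node_arith.
apply: (@iso_to_sub_two_chains _ _ _ _ _ _ inD _
          (fun x => if x == 0 then 0 else x + 2 * p)
          (fun y => if y < (2 * p).+1 then 0 else y - 2 * p)).
- by move=> y; rewrite inE.
- by move=> x xN; rewrite /inD; split; node_arith.
- by move=> y yN; rewrite /inD; node_arith.
- by move=> x x' xN xN'; node_arith.
Qed.

Hypothesis p_gt0 : 0 < p.

Definition witness_poset_slice a b (top : bool) (y : nat) :=
  [|| y < a, (2 * p).+1 <= y < (2 * p).+1 + b | top && (y == (4 * p).+1)].

Lemma slice_with_top_node a b (D : {set 'I_(pcard witness_poset)}) :
  (2 * p).-1 <= b <= 2 * p -> a + b + 1 = node_size ->
  (forall y, (y \in D) = witness_poset_slice a b true y) -> exists i, iso_to_sub (node i) D.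
Proof.
move=> b_bounds cardD Dchar.
have [b_eq|b_eq] : b = 2 * p \/ b = (2 * p).-1 by lia.
  exists ord_max.
  apply: (@iso_to_sub_two_chains _ _ _ _ _ _ (witness_poset_slice a b true) D
            (fun x => if x == 0 then 0 else x + 2 * p)
            (fun y => if y < (2 * p).+1 then 0 else y - 2 * p) Dchar).
  - by move=> x xN; rewrite /witness_poset_slice; split; node_arith.
  - by move=> y yN; rewrite /witness_poset_slice; node_arith.
  - by move=> x x' xN xN'; node_arith.
have i_lt : 1 < p.+2 by [].
exists (Ordinal i_lt).
apply: (@iso_to_sub_two_chains _ _ _ _ _ _ (witness_poset_slice a b true) D
          (fun x => if x < (2 * p).-1 then x + (2 * p).+1
                    else if x == (2 * p).-1 then (4 * p).+1 else x - 2 * p)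
          (fun y => if y < (2 * p).+1 then y + 2 * p
                    else if y == (4 * p).+1 then (2 * p).-1 else y - (2 * p).+1) Dchar).
- by move=> x xN; rewrite /witness_poset_slice; split; node_arith.
- by move=> y yN; rewrite /witness_poset_slice; node_arith.
- by move=> x x' xN xN'; node_arith.
Qed.

Lemma slice_without_top_node a b (D : {set 'I_(pcard witness_poset)}) :
  a <= (2 * p).+1 -> b <= 2 * p -> a + b = node_size ->
  (forall y, (y \in D) = witness_poset_slice a b false y) -> exists i, iso_to_sub (node i) D.
Proof.
move=> a_le b_bound cardD Dchar.
have [b_le|b_gt] := leqP b p.+1.
  have i_lt : b.-1 < p.+2 by lia.
  exists (Ordinal i_lt).
  apply: (@iso_to_sub_two_chains _ _ _ _ _ _ (witness_poset_slice a b false) D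
            (fun x => if x < node_size - b then x else x + b - 1)
            (fun y => if y < (2 * p).+1 then y else y + 1 - b) Dchar).
  - by move=> x xN; rewrite /witness_poset_slice; split; node_arith.
  - by move=> y yN; rewrite /witness_poset_slice; node_arith.
  - by move=> x x' xN xN'; node_arith.
have i_lt : a.-1 < p.+2 by rewrite /node_size in cardD; lia.
exists (Ordinal i_lt).
apply: (@iso_to_sub_two_chains _ _ _ _ _ _ (witness_poset_slice a b false) D
          (fun x => if x < b then x + (2 * p).+1 else x - b)
          (fun y => if y < (2 * p).+1 then y + b else y - (2 * p).+1) Dchar).
- by move=> x xN; rewrite /witness_poset_slice; split; node_arith.
- by move=> y yN; rewrite /witness_poset_slice; node_arith.
- by move=> x x' xN xN'; node_arith.
Qed.

Lemma witness_poset_downset_node (D : {set 'I_(pcard witness_poset)}) :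
  is_downset D -> #|D| = node_size -> exists i, iso_to_sub (node i) D.
Proof.
move=> Ddown Dn.
have mN : (2 * p).+3 <= (4 * p).+2 by lia.
have [a [b [top [a_le b_le top_b cardD Dchar]]]] := forked_downset_shape mN Ddown.
rewrite Dn in cardD; case: top top_b cardD Dchar => [/(_ isT) b_ge | _] cardD Dchar.
  apply: (@slice_with_top_node a b) => [||y]; [move: b_ge b_le; lia | by rewrite cardD |].
  exact: Dchar.
apply: (@slice_without_top_node a b) => [|||y]; [exact: a_le | move: b_le; lia | |].
  by rewrite cardD addn0.
exact: Dchar.
Qed.

Lemma cmp_count_node_chains (i : 'I_p.+2) (x : 'I_node_size) : i < p.+1 ->
  @cmp_count (node i) x = if x < node_size - i.+1 then node_size - i.+1 else i.+1.
Proof.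
move=> ip; have unforked : (p.+1 <= i) = false by rewrite leqNgt ip.
rewrite /node /node_split ip unforked cmp_count_two_chains /node_size; last by lia.
by case: ifP; lia.
Qed.

Lemma cmp_count_node_fork_bottom (i : 'I_p.+2) (x : 'I_node_size) :
  ~~ (i < p.+1) -> x = 0 :> nat -> @cmp_count (node i) x = 1.
Proof.
move=> ip x0; rewrite /node /node_split (negbTE ip) leqNgt ip.
exact: cmp_count_fork_bottom.
Qed.

Lemma cmp_count_node_fork_top (i : 'I_p.+2) (x : 'I_node_size) :
  ~~ (i < p.+1) -> x = node_size.-1 :> nat -> @cmp_count (node i) x = node_size - 2.
Proof.
move=> ip xtop; rewrite /node /node_split (negbTE ip) leqNgt ip.
by apply: cmp_count_fork_top => //; rewrite /node_size; lia.
Qed.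

Lemma node_iso_inj (i j : 'I_p.+2) : poset_iso (node i) (node j) -> i = j.
Proof.
case=> f [bij_f f_le].
have cf := cmp_count_iso bij_f f_le.
have [g fK gK] := bij_f.
have cg y : cmp_count (g y) = cmp_count y by rewrite cf gK.
have ip := ltn_ord i; have jp := ltn_ord j.
have bot_lt : 0 < node_size by [].
have top_lt : node_size.-1 < node_size by [].
pose bot := Ordinal bot_lt; pose top := Ordinal top_lt.
case: (boolP (i < p.+1)) => ichain; case: (boolP (j < p.+1)) => jchain.
- have := cf top; rewrite !cmp_count_node_chains //; have := ltn_ord (f top).
  by case: ifP => _; case: ifP => _; rewrite /= /node_size => *; apply/val_inj => /=; lia.
- move: (cg bot) (cg top); rewrite !(@cmp_count_node_chains i) //.
  rewrite cmp_count_node_fork_bottom // cmp_count_node_fork_top //.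
  by case: ifP => _; case: ifP => _; rewrite /node_size; lia.
- move: (cf bot) (cf top); rewrite !(@cmp_count_node_chains j) //.
  rewrite cmp_count_node_fork_bottom // cmp_count_node_fork_top //.
  by case: ifP => _; case: ifP => _; rewrite /node_size; lia.
- by apply/val_inj => /=; lia.
Qed.

End Construction.

Lemma node_split_bounds p (i : 'I_p.+2) : 0 < node_split p i < node_size p.
Proof. by rewrite /node_split /node_size; case: ifP; lia. Qed.

Lemma iso_to_sub_least (P Q : fposet) (D : {set 'I_(pcard Q)}) (r : 'I_(pcard Q)) :
  iso_to_sub P D -> r \in D -> (forall u, u \in D -> @ple Q r u) ->
  exists x, forall y, @ple P x y.
Proof.
case=> h [_ D_img h_le] rD r_least.
have [x hx] := (D_img r).1 rD.
by exists x => y; rewrite h_le hx; apply: r_least; apply/D_img; exists y.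
Qed.

Section LowerBound.
Variables (p : nat) (Q : fposet).
Hypothesis p_gt0 : 0 < p.
Local Notation n := (node_size p).
Local Notation m := (2 * p).+1.
Local Notation le := (@ple Q).

Hypothesis node_downsets : forall D : {set 'I_(pcard Q)},
  is_downset D -> #|D| = n -> exists i : 'I_p.+2, iso_to_sub (node i) D.

Lemma downset_no_least (D : {set 'I_(pcard Q)}) r :
  is_downset D -> #|D| = n -> r \in D -> ~ (forall u, u \in D -> le r u).
Proof.
move=> Ddown Dn rD r_least; have [i iso] := node_downsets Ddown Dn.
have [x x_least] := iso_to_sub_least iso rD r_least.
exact: (two_chains_no_least (node_split_bounds i) x_least).
Qed.

Variables (D1 D2 : {set 'I_(pcard Q)}) (f1 f2 : 'I_n -> 'I_(pcard Q)).
Hypotheses (D1_down : is_downset D1) (D2_down : is_downset D2).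
Hypotheses (f1_inj : injective f1) (f2_inj : injective f2).
Hypothesis D1_img : forall y, y \in D1 <-> exists x, f1 x = y.
Hypothesis D2_img : forall y, y \in D2 <-> exists x, f2 x = y.
Hypothesis f1_le : forall x y : 'I_n, two_chains_le n m false x y = le (f1 x) (f1 y).
Hypothesis f2_le : forall x y : 'I_n, two_chains_le n 1 true x y = le (f2 x) (f2 y).

Let chain := f1 @: [set x : 'I_n | x < m].
Let fork := f2 @: [set x : 'I_n | 0 < x].

Let n_gt0 : 0 < n. Proof. by []. Qed.
Let n_gt1 : 1 < n. Proof. by rewrite /node_size. Qed.
Let bot := Ordinal n_gt0.
Let one := Ordinal n_gt1.

Lemma card_chain : #|chain| = m.
Proof. by rewrite card_imset // card_ord_lt // /node_size. Qed.

Lemma card_fork : #|fork| = m.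
Proof.
have -> : m = n - 1 by rewrite /node_size; lia.
rewrite card_imset // -(card_ord_range 1 (leqnn n)).
by apply: eq_card => x; rewrite !inE ltn_ord andbT.
Qed.

Lemma chain_least u : u \in chain -> le (f1 bot) u.
Proof. by case/imsetP=> x; rewrite inE => xm ->; rewrite -f1_le /two_chains_le /=; lia. Qed.

Lemma chain_total u w : u \in chain -> w \in chain -> le u w || le w u.
Proof.
case/imsetP=> x; rewrite inE => xm ->; case/imsetP=> y; rewrite inE => ym ->.
by rewrite -!f1_le /two_chains_le; lia.
Qed.

Lemma chain_downset : is_downset chain.
Proof.
move=> u w wu uchain; case/imsetP: (uchain) => x; rewrite inE => xm ux.
have [y wy] := (D1_img w).1 (D1_down wu ((D1_img u).2 (ex_intro _ x (esym ux)))).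
apply/imsetP; exists y; rewrite ?inE //.
have : two_chains_le n m false y x by rewrite f1_le wy -ux.
by move/two_chains_le_leq; lia.
Qed.

Lemma fork_outside_chain : exists x : 'I_n, (0 < x) && (f2 x \notin chain).
Proof.
have top1_lt : n.-2 < n by rewrite /node_size; lia.
have top2_lt : n.-1 < n by rewrite /node_size; lia.
have [t1|t1] := boolP (f2 (Ordinal top1_lt) \in chain); last first.
  by exists (Ordinal top1_lt); rewrite t1 andbT /= /node_size; lia.
have [t2|t2] := boolP (f2 (Ordinal top2_lt) \in chain); last first.
  by exists (Ordinal top2_lt); rewrite t2 andbT /= /node_size; lia.
by have := chain_total t1 t2; rewrite -!f2_le /two_chains_le /= /node_size; lia.
Qed.

Lemma chain_fork_meet z : z \in chain -> z \in fork -> f1 bot = f2 one.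
Proof.
move=> zc /imsetP[t]; rewrite inE => t_pos zt.
have bot_D2 : f1 bot \in D2.
  by apply: (D2_down (chain_least zc)); apply/D2_img; exists t; rewrite zt.
have [w wbot] := (D2_img _).1 bot_D2.
have w_pos : 0 < w.
  have : two_chains_le n 1 true w t by rewrite f2_le wbot -zt chain_least.
  by rewrite /two_chains_le; lia.
have one_le_bot : le (f2 one) (f1 bot).
  by rewrite -wbot -f2_le /two_chains_le /=; have : n = (2 * p).+2 by []; lia.
have one_D1 : f2 one \in D1 by apply: (D1_down one_le_bot); apply/D1_img; exists bot.
have [u uone] := (D1_img _).1 one_D1.
have : two_chains_le n m false u bot by rewrite f1_le uone.
move/two_chains_le_leq; rewrite /bot /= => u_bot.
by rewrite -uone; congr f1; apply/val_inj => /=; lia.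
Qed.

Lemma chain_fork_disjoint : chain :&: fork = set0.
Proof.
apply/setP => z; rewrite inE in_set0; apply/negP => /andP[zc zf].
have bot_one := chain_fork_meet zc zf.
have [x0 x0_out] := fork_outside_chain.
case: (@arg_minnP _ x0 (fun x : 'I_n => (0 < x) && (f2 x \notin chain)) val x0_out)
  => x /andP[x_pos x_out] x_min.
pose D := f2 x |: chain.
have Ddown : is_downset D.
  move=> u w wu; rewrite !inE => /orP[/eqP ux | uc].
    2: by rewrite (chain_downset wu uc) orbT.
  have [t wt] := (D2_img w).1 (D2_down wu ((D2_img u).2 (ex_intro _ x (esym ux)))).
  have tx : two_chains_le n 1 true t x by rewrite f2_le wt -ux.
  have [t_eq|t_ne_x] := eqVneq t x; first by rewrite -wt t_eq eqxx.
  apply/orP; right; rewrite -wt; move: t_ne_x; apply: contraTT; rewrite negbK => t_out.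
  apply/eqP/val_inj/eqP; rewrite eqn_leq (two_chains_le_leq tx) x_min //.
  by rewrite t_out andbT; move: tx; rewrite /two_chains_le; lia.
have Dn : #|D| = n by rewrite cardsU1 x_out card_chain /node_size.
apply: (downset_no_least Ddown Dn (r := f1 bot)).
  by rewrite !inE; apply/orP; right; apply/imsetP; exists bot; rewrite ?inE.
move=> u; rewrite !inE => /orP[/eqP -> | /chain_least //].
by rewrite bot_one -f2_le /two_chains_le /=; have : n = (2 * p).+2 by []; lia.
Qed.

Lemma chain_fork_card : 2 * m <= pcard Q.
Proof.
have := subset_leq_card (subsetT (chain :|: fork)).
by rewrite cardsU chain_fork_disjoint cards0 card_chain card_fork cardsT card_ord; lia.
Qed.

End LowerBound.

Lemma witness_card_lower_bound p (Q : fposet) :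
  0 < p -> witness (node_size p) (@node p) Q -> 2 * (2 * p).+1 <= pcard Q.
Proof.
move=> p_gt0 [node_downsets node_embeds].
have [D1 [D1_down [f1 [f1_inj D1_img f1_le]]]] := node_embeds ord0.
have [D2 [D2_down [f2 [f2_inj D2_img f2_le]]]] := node_embeds ord_max.
apply: (@chain_fork_card p Q p_gt0 node_downsets D1 D2 f1 f2) => // x y.
by rewrite -f2_le /= /node_split ltnn leqnn.
Qed.

Theorem mainTheorem3 :
  forall c : nat, exists (n k : nat) (Gamma : 'I_k -> fposet),
    covtree_node n Gamma /\
    forall Q : fposet, witness n Gamma Q -> n + k + c < pcard Q.
Proof.
move=> c; pose p := c + 3; have p_gt0 : 0 < p by rewrite /p addn3.
exists (node_size p), p.+2, (@node p); split.
  split=> // [i j|]; first exact: node_iso_inj.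
  exists (witness_poset p); split; first exact: witness_poset_downset_node.
  exact: node_in_witness_poset.
by move=> Q /(witness_card_lower_bound p_gt0); rewrite /node_size /p; lia.
Qed.
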